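(* Let $a,b,d$ be three pairwise coprime positive integers such that $d\notin\langle a,b\rangle$ and $a<b$, and let $S=\langle a,b\rangle/d$. Case 1: if $(a-1)(b-1)\equiv1\pmod d$, then $S$ is symmetric (its type is $1$) and $f(S)=\frac{f(\langle a,b\rangle)}{d}=\frac{ab-a-b}{d}$. Case 2: if $a\equiv1\pmod d$, then $\mathrm{PF}(S)=\frac{(a-1)b}{d}-\big(\mathrm{Irr}(S)\setminus\{b\}\big)$. Case 3: if $b\equiv1\pmod d$, then $\mathrm{PF}(S)=\frac{(b-1)a}{d}-\big(\mathrm{Irr}(S)\setminus\{a\}\big)$. In Cases 2 and 3, $t(S)=e(S)-1$.
   Context: $\langle a,b\rangle=\{xa+yb:x,y\in\mathbb{N}\}$; $S/d=\{x\in\mathbb{N}:dx\in S\}$. For a numerical semigroup $S$: $\mathrm{Irr}(S)$ is its minimal generating set, $e(S)=\#\mathrm{Irr}(S)$; $\mathrm{PF}(S)=\{x\in\mathbb{Z}\setminus S: x+s\in S \text{ for all nonzero } s\in S\}$, $t(S)=\#\mathrm{PF}(S)$ (the type); $f(S)=\max(\mathbb{Z}\setminus S)$; $S$ is symmetric if $\#\{s\in S: s<f(S)\}=\#(\mathbb{N}\setminus S)$. For $x\in\mathbb{Z}$ and $A\subseteq\mathbb{Z}$, $x-A=\{x-y:y\in A\}$. *)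

(* Defs.v *)
From HB Require Import structures.
From mathcomp Require Import all_boot all_order all_algebra.
From mathcomp Require Import finmap.
From mathcomp Require Import boolp classical_sets functions cardinality.

Set Implicit Arguments.
Unset Strict Implicit.
Unset Printing Implicit Defensive.

Local Open Scope classical_set_scope.

(** Semigroups are subsets of [nat]; [intset S] is the same set inside [int]. *)
Definition intset (S : set nat) : set int := Posz @` S.

Definition gen2 (a b : nat) : set nat :=
  [set n | exists x y : nat, n = x * a + y * b].

Definition quot (S : set nat) (d : nat) : set nat := [set x | S (d * x)].

Definition submonoid (M : set nat) : Prop :=
  M 0 /\ (forall x y, M x -> M y -> M (x + y)).

Definition generates (A S : set nat) : Prop := smallest submonoid A = S.

Definition minimal_generating_set (S A : set nat) : Prop :=
  generates A S /\ (forall B : set nat, B `<=` A -> generates B S -> B = A).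

(** The minimal generating set of a submonoid of [nat] exists and is unique, so
    the default value [set0] is never used when [S] is a numerical semigroup. *)
Definition Irr (S : set nat) : set nat := xget set0 (minimal_generating_set S).

(** Number of elements of a finite set; [0] for an infinite set. *)
Definition ncard (T : choiceType) (A : set T) : nat := #|` fset_set A|%fset.

Definition embdim (S : set nat) : nat := ncard (Irr S).

Definition PF (S : set nat) : set int :=
  [set x | ~ intset S x /\
           (forall s : nat, S s -> s <> 0 -> intset S (x + s%:Z)%R)].

Definition sgtype (S : set nat) : nat := ncard (PF S).

Definition is_max (A : set int) (m : int) : Prop := A m /\ ubound A m.

(** The default value [0] is only used when the complement of [S] in [int] has
    no maximum, which never happens for a numerical semigroup. *)
Definition frob (S : set nat) : int := xget 0%R (is_max (~` intset S)).

(** [#=] is equipotence; the left-hand set is always finite. *)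
Definition symmetric_sg (S : set nat) : Prop :=
  ([set s | S s /\ (s%:Z < frob S)%R] #= ~` S)%card.

Definition subl (x : int) (A : set nat) : set int :=
  [set (x - y%:Z)%R | y in A].

(* Main.v *)
Require Import Defs.
From HB Require Import structures.
From mathcomp Require Import all_boot all_order all_algebra.
From mathcomp Require Import finmap.
From mathcomp Require Import boolp classical_sets functions cardinality.
From mathcomp Require Import zify ring.

(** Everything rests on the symmetry of [<a, b>]: an integer [z] lies in it if
    and only if [ab - a - b - z] does not.  If [d] divides [ab - a - b], dividing
    by [d] gives the same symmetry for [S].  If [a = q d + 1], then
    [ab - a - b = d (q b) - a], so [z] is a gap of [S] if and only if
    [d (q b - z)] has a representation [i a + j b] with [i > 0].  Let [T] be the
    set of [y] such that [d y] has such a representation: pseudo-Frobenius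
    numbers are thus the [q b - y] with [y] minimal in [T] for the order
    induced by [S].  The elements of [S] outside [T] are multiples of [b], and
    the first multiple of [b] in [T] is not minimal, so the minimal elements of
    [T] are exactly the irreducible elements of [S] other than [b].  Exchanging
    [a] and [b] gives the case [b = 1] modulo [d]. *)

Set Implicit Arguments.
Unset Strict Implicit.

Import Order.TTheory GRing.Theory Num.Theory.

Local Open Scope classical_set_scope.

(** * Irreducible elements and minimal generators *)

Definition irreducibles (S : set nat) : set nat :=
  [set n | [/\ S n, n <> 0 &
    forall s t, S s -> S t -> s <> 0 -> t <> 0 -> n <> s + t]].

Lemma smallest_submonoid (A : set nat) : submonoid (smallest submonoid A).
Proof.
split=> [M [[M0 _] _] //|x y Ax Ay M [[M0 MD] AM]].
have CM := conj (conj M0 MD) AM.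
by apply: MD; [exact: Ax CM|exact: Ay CM].
Qed.

Lemma generates_irreducibles (S : set nat) :
  submonoid S -> generates (irreducibles S) S.
Proof.
move=> Ssub; apply/seteqP; split; first by apply: smallest_sub => // x [].
have [J0 JD] := smallest_submonoid (irreducibles S).
elim/ltn_ind => n IH Sn; have [->//|/eqP n0] := eqVneq n 0.
have [In|nIn] := pselect (irreducibles S n); first exact: sub_gen_smallest.
have [s [t [Ss St s0 t0 nst]]] :
    exists s t, [/\ S s, S t, s <> 0, t <> 0 & n = s + t].
  apply: contrapT => H; apply: nIn; split=> // s t Ss St s0 t0 nst.
  by apply: H; exists s, t.
by rewrite nst; apply: JD; apply: IH => //; lia.
Qed.

(* If [x] is irreducible then [S] minus [x] is still a submonoid. *)
Lemma irreducibles_sub_generates (S B : set nat) :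
  submonoid S -> generates B S -> irreducibles S `<=` B.
Proof.
move=> [S0 SD] BS x [Sx x0 xirr]; apply: contrapT => nBx.
have BsubS : B `<=` S by rewrite -BS; exact: sub_gen_smallest.
suff : smallest submonoid B `<=` S `\ x.
  by rewrite BS => /(_ x Sx) [_]; apply.
apply: smallest_sub => [|y By]; last first.
  by split; [exact: BsubS|move=> /= yx; apply: nBx; rewrite -yx].
split=> [|y z [Sy yx] [Sz zx]]; first by split=> //= /esym.
split=> /=; first exact: SD.
have [->|/eqP y0] := eqVneq y 0; first by rewrite add0n.
have [->|/eqP z0] := eqVneq z 0; first by rewrite addn0.
by move=> /esym; exact: xirr.
Qed.

(** The irreducibles generate and lie in every generating set, so no other generating set is
    minimal. *)
Lemma IrrE (S : set nat) : submonoid S -> Irr S = irreducibles S.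
Proof.
move=> Ssub; have gI := generates_irreducibles Ssub.
apply: xget_unique.
  split=> // B BI gB; apply/seteqP; split=> //.
  exact: irreducibles_sub_generates.
by move=> A [gA minA]; rewrite (minA _ (irreducibles_sub_generates Ssub gA)).
Qed.

(** * Membership in [gen2 a b] and its quotients *)

Lemma intset_nat (S : set nat) (n : nat) : intset S (Posz n) <-> S n.
Proof. by split=> [[m Sm [<-]]//|Sn]; exists n. Qed.

Lemma intset_ge0 (S : set nat) (z : int) : intset S z -> (0 <= z)%R.
Proof. by case=> n _ <-. Qed.

Lemma submonoid_gen2 (a b : nat) : submonoid (gen2 a b).
Proof.
split=> [|_ _ [i [j ->]] [k [l ->]]]; first by exists 0, 0.
by exists (i + k), (j + l); lia.
Qed.

Lemma submonoid_quot (S : set nat) (d : nat) :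
  submonoid S -> submonoid (quot S d).
Proof.
move=> [S0 SD]; split=> [|x y Sx Sy]; first by rewrite /quot/= muln0.
by rewrite /quot/= mulnDr; exact: SD.
Qed.

Lemma intset_gen2 (a b : nat) (z : int) :
  intset (gen2 a b) z <->
  exists x y : nat, (z = x%:Z * a%:Z + y%:Z * b%:Z)%R.
Proof.
split=> [[_ [x [y ->]] <-]|[x [y ->]]]; first by exists x, y; lia.
by exists (x * a + y * b); [exists x, y|lia].
Qed.

Lemma intset_quot (S : set nat) (d : nat) (z : int) : 0 < d ->
  intset (quot S d) z <-> intset S (d%:Z * z)%R.
Proof.
move=> d0; split=> [[x Sx <-]|[n Sn dz]]; first by exists (d * x).
have z0 : (0 <= z)%R by rewrite -(@pmulr_rge0 _ (Posz d)) // -dz.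
case: z z0 dz => // m _ dz; apply/intset_nat.
rewrite /quot/=; suff -> : d * m = n by [].
by lia.
Qed.

(** In any representation [x * a + y * b], coprimality and [i < b] force [x = i + k * b] with
    [k >= 0], whence [j = y + k * a]. *)
Lemma gen2_reduced (a b : nat) (i j : int) : coprime a b ->
  (0 <= i < b%:Z)%R ->
  intset (gen2 a b) (i * a%:Z + j * b%:Z)%R <-> (0 <= j)%R.
Proof.
move=> cab /andP[i0 ib]; rewrite intset_gen2; split=> [[x [y e]]|j0]; last first.
  by exists `|i|%N, `|j|%N; rewrite !gez0_abs.
have : (Posz b %| ((x%:Z - i) * a%:Z)%R)%Z.
  by apply/dvdzP; exists (j - y%:Z)%R; lia.
rewrite Gauss_dvdzl; last by rewrite coprimezE /= coprime_sym.
move=> /dvdzP[k ek].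
have k0 : (0 <= k)%R by nia.
have -> : (j = y%:Z + k * a%:Z)%R by apply: (@mulIf _ (Posz b)); nia.
by nia.
Qed.

(** If [z = r * a + j * b] with [0 <= r < b], its reflection has coefficients [b - 1 - r], again
    reduced, and [- 1 - j]; exactly one of [j] and [- 1 - j] is nonnegative. *)
Lemma gen2_symmetry (a b : nat) (z : int) : coprime a b -> 0 < b ->
  intset (gen2 a b) z <->
  ~ intset (gen2 a b) (a%:Z * b%:Z - a%:Z - b%:Z - z)%R.
Proof.
move=> cab b0; have [u [v uv]] := Bezoutz (Posz a) (Posz b).
have {}uv : (u * a%:Z + v * b%:Z = 1)%R.
  by rewrite uv /gcdz /= (eqP cab).
have bz : Posz b != 0%R by lia.
have r0 := modz_ge0 (z * u)%R bz.
have rb := ltz_mod (z * u)%R bz.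
set q := ((z * u)%R %/ Posz b)%Z; set r := ((z * u)%R %% Posz b)%Z in r0 rb.
have zu : (z * u = q * b%:Z + r)%R := divz_eq _ _.
have -> : z = (r * a%:Z + (z * v + q * a%:Z) * b%:Z)%R.
  rewrite -[LHS]mulr1 -uv mulrDr mulrA zu; ring.
move: (z * v + q * a%:Z)%R => j.
have -> : (a%:Z * b%:Z - a%:Z - b%:Z - (r * a%:Z + j * b%:Z) =
  (b%:Z - 1 - r) * a%:Z + (- 1 - j) * b%:Z)%R by ring.
rewrite !gen2_reduced //; lia.
Qed.

(** * Symmetric semigroups *)

Section Complemented.

(* The condition [z \in S <-> F - z \notin S] is the usual reformulation of
   symmetry with Frobenius number [F]. *)
Variables (S : set nat) (F : int).
Hypotheses (S0 : S 0)
  (SF : forall z, intset S z <-> ~ intset S (F - z)%R).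

Lemma complemented_notin : ~ intset S F.
Proof. by move/SF; rewrite subrr; apply; apply/intset_nat. Qed.

Lemma complemented_frob : frob S = F.
Proof.
have maxF : is_max (~` intset S) F.
  split=> [|z /= nz]; first exact: complemented_notin.
  rewrite -subr_ge0; apply: (@intset_ge0 S).
  by apply: contrapT => h; apply: nz; apply/SF.
apply: xget_unique => // m [nm um].
by apply/eqP; rewrite eq_le (maxF.2 _ nm) (um _ maxF.1).
Qed.


Lemma complemented_symmetric : symmetric_sg S.
Proof.
rewrite /symmetric_sg complemented_frob.
apply/card_set_bijP; exists (fun n => `|(F - n%:Z)%R|%N); split.
- move=> n /= [Sn nF] SFn; move/intset_nat/SF: Sn; apply.
  have -> : (F - n%:Z)%R = Posz `|(F - n%:Z)%R|%N by lia.
  exact/intset_nat.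
- move=> m n; rewrite !inE /= => -[_ mF] [_ nF]; lia.
- move=> n /= nSn.
  have SFn : intset S (F - n%:Z)%R.
    by apply: contrapT => h; apply/nSn/intset_nat/SF.
  have Fn := intset_ge0 SFn.
  have n0 : n <> 0 by move=> n0; apply: nSn; rewrite n0.
  exists `|(F - n%:Z)%R|%N; last by lia.
  split; last by lia.
  by apply/intset_nat; rewrite gez0_abs.
Qed.

(** For a gap [x] other than [F], [F - x] is a nonzero element of [S]; were [x] pseudo-Frobenius,
    [F] would lie in [S]. *)
Lemma complemented_type : sgtype S = 1.
Proof.
suff PFE : PF S = [set F] by rewrite /sgtype PFE /ncard fset_set1 cardfs1.
apply/seteqP; split=> [x [nx xs]|_ ->] /=; last first.
  split=> [|s Ss s0]; first exact: complemented_notin.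
  apply/SF => /intset_ge0; lia.
have : intset S (F - x)%R by apply: contrapT => h; apply/nx/SF.
case=> s Ss es; apply: contrapT => Fx.
have /xs : S s := Ss; rewrite es => h.
apply: complemented_notin; suff -> : F = (x + (F - x))%R.
  by apply: h => s0; apply: Fx; lia.
by lia.
Qed.

End Complemented.

(** For [y] beyond [a * b + a], [d * (y - a)] exceeds the Frobenius number of [gen2 a b], so [y]
    splits as [a + (y - a)]. *)
Lemma finite_irreducibles_quot (a b d : nat) :
  coprime a b -> 0 < a -> 0 < b -> 0 < d ->
  finite_set (irreducibles (quot (gen2 a b) d)).
Proof.
move=> cab a0 b0 d0; apply: (sub_finite_set _ (finite_II (a * b + a).+1)).
move=> y [_ _ yirr] /=; rewrite ltnNge; apply/negP => ylarge.
have Sa : quot (gen2 a b) d a by exists d, 0; lia.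
apply: (yirr a (y - a) Sa); try lia.
apply/intset_nat/intset_quot => //; apply/gen2_symmetry => // -[n _].
have : a * b + 1 <= d * (y - a) by nia.
by nia.
Qed.

(** * The case of [a] congruent to 1 modulo [d] *)

Section Congruent.

Variables (a b d q : nat).
Hypotheses (b1 : 1 < b) (d0 : 0 < d) (q0 : 0 < q) (cab : coprime a b)
  (cbd : coprime b d) (aE : a = q * d + 1).

Let S : set nat := quot (gen2 a b) d.

(* Since [d * (q * b) - a] is the Frobenius number of [<a, b>], reflection
   through [q * b] sends the gaps of [S] to the elements of [S] that admit a
   representation involving [a]. *)
Let withA (y : int) : Prop :=
  exists i j : nat, (d%:Z * y = (i.+1)%:Z * a%:Z + j%:Z * b%:Z)%R.

Lemma gap_reflection (z : int) :
  ~ intset S z <-> withA ((q * b)%N%:Z - z)%R.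
Proof.
rewrite /S intset_quot // gen2_symmetry //; last by lia.
have -> : (a%:Z * b%:Z - a%:Z - b%:Z - d%:Z * z
   = d%:Z * ((q * b)%N%:Z - z) - a%:Z)%R by rewrite aE; lia.
rewrite intset_gen2; split.
  by move=> /contrapT[x [y e]]; exists x, y; lia.
by move=> [x [y e]]; apply; exists x, y; lia.
Qed.

(** Coprimality makes [i] a multiple of [b], so a nonzero [i] contributes at least [a * b]. *)
Lemma multiple_b_repr (k i j : nat) :
  d * (k * b) = i * a + j * b -> i = 0 \/ a <= k * d.
Proof.
move=> e; have : b %| i * a.
  by rewrite -(@dvdn_addl (j * b)) ?dvdn_mull // -e mulnA dvdn_mull.
rewrite Gauss_dvdl 1?coprime_sym // => /dvdnP[[|l] il]; first by left.
right; nia.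
Qed.

Lemma only_b_multiple (t j : nat) : d * t = j * b -> exists k, t = k * b.
Proof.
move=> e; have : d %| j * b by rewrite -e dvdn_mulr.
rewrite Gauss_dvdl 1?coprime_sym // => /dvdnP[k jk]; exists k.
by apply/eqP; rewrite -(eqn_pmul2l d0) e jk; apply/eqP; lia.
Qed.

Lemma withA_or_multiple (t : nat) :
  S t -> withA t%:Z%R \/ exists k, t = k * b.
Proof.
move=> [[|i] [j e]]; first by right; apply: (@only_b_multiple _ j); lia.
by left; exists i, j; lia.
Qed.

Lemma withA_in (y : int) :
  withA y -> exists n : nat, [/\ y = Posz n, S n & n <> 0].
Proof.
move=> [i [j e]]; have y0 : (0 <= y)%R.
  by rewrite -(@pmulr_rge0 _ (Posz d)) // e; lia.
case: y y0 e => // n _ e; exists n; split=> //; first by exists i.+1, j; lia.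
by move=> n0; move: e; rewrite n0 mulr0; lia.
Qed.

Lemma withA_multiple (k : nat) : withA (Posz (k * b)) <-> a <= k * d.
Proof.
split=> [[i [j e]]|le].
  have e' : d * (k * b) = i.+1 * a + j * b by lia.
  by have [] := multiple_b_repr e'.
(* [withA] counts the coefficient of [a] from one, so [b.-1] stands for [b] copies of [a]. *)
exists b.-1, (k * d - a); rewrite prednK; last by lia.
by rewrite -subzn //; lia.
Qed.

Lemma mem_b : S b.
Proof. by exists 0, d; lia. Qed.

(** [withA] absorbs addition of elements of [S] and misses [b], as [d < a]; both summands would then
    be positive multiples of [b]. *)
Lemma irreducible_b : irreducibles S b.
Proof.
split=> [||s t Ss St s0 t0 bst]; [exact: mem_b|by lia|].
have nb : ~ withA (Posz b) by rewrite -[b]mul1n withA_multiple; nia.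
have addA x y : withA (Posz x) -> S y -> withA (Posz (x + y)).
  by move=> [i [j e]] [k [l f]]; exists (i + k), (j + l); lia.
have [As|[k sk]] := withA_or_multiple Ss.
  by apply: nb; rewrite bst; exact: addA.
have [At|[l tl]] := withA_or_multiple St.
  by apply: nb; rewrite bst addnC; exact: addA.
by case: k l sk tl => [|k] [|l] sk tl; nia.
Qed.

Lemma PF_reflection : PF S = subl (Posz (q * b)) (irreducibles S `\ b).
Proof.
apply/seteqP; split=> [x [nx xs]|_ [y [[Sy y0 yirr] yb] <-]] /=; last first.
  split=> [|s Ss s0].
    apply/gap_reflection; rewrite subKr.
    have [//|[k yk]] := withA_or_multiple Sy.
    case: k yk => [|[|k]] yk; [by lia|by case: yb; rewrite /= yk mul1n|].
    have Sk : S (k.+1 * b) by exists 0, (d * k.+1); lia.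
    by case: (yirr b (k.+1 * b) mem_b Sk); lia.
  apply: contrapT => /gap_reflection/withA_in[t [e St t0]].
  by apply: (yirr s t Ss St s0 t0); lia.
have /gap_reflection Ay := nx; have [y [ey Sy y0]] := withA_in Ay.
rewrite ey in Ay.
(* Since [x + s] is not a gap, its reflection [y - s] fails [withA]. *)
have minA s : S s -> s <> 0 -> ~ withA (Posz y - Posz s)%R.
  move=> Ss s0 As; have := xs s Ss s0; apply/gap_reflection.
  by rewrite opprD addrA ey.
exists y; last by rewrite -ey subKr.
split; last first.
  by move=> /= yb; move: Ay; rewrite yb -[b]mul1n withA_multiple; nia.
split=> // s t Ss St s0 t0 yst.
have [As|[k sk]] := withA_or_multiple Ss.
  by apply: (minA t St t0); rewrite yst PoszD addrK.
have [At|[l tl]] := withA_or_multiple St.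
  by apply: (minA s Ss s0); rewrite yst PoszD addrC addKr.
have {sk tl} yE : y = (k + l) * b by lia.
(* [q.+1] is the least [m] with [a <= m * d]; a larger sum would let [b] be subtracted within
   [withA]. *)
have kl : k + l = q.+1.
  move: Ay; rewrite yE withA_multiple => le1.
  have : ~ withA (Posz ((k + l).-1 * b)).
    have -> : Posz ((k + l).-1 * b) = (Posz y - Posz b)%R by nia.
    by apply: minA; [exact: mem_b|lia].
  by rewrite withA_multiple; nia.
(* The first multiple of [b] in [withA] is not minimal there: its [d]-fold is
   [b * a + (d - 1) * b], from which [a + j * b] can be subtracted. *)
have [j jd] := Bezoutl b d0; rewrite gcdnC (eqP cbd) => dj.
have /dvdnP[s' es'] : d %| a + j * b.
  by rewrite aE -addnA dvdn_addr // dvdn_mull.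
apply: (minA s'); first by exists 1, j; lia.
  by move=> s'0; move: es'; rewrite s'0; lia.
(* Here [d * (y - s')] equals [(b - 1) * a + (d - 1 - j) * b], and [j < d]. *)
exists (b - 2), (d - 1 - j); rewrite yE kl.
have -> : (b - 2).+1 = b - 1 by lia.
rewrite mulrBr (mulrC _ (Posz s')) -[(Posz s' * _)%R]PoszM -es'.
by rewrite -!subzn; nia.
Qed.

End Congruent.

(** * Type, embedding dimension and the three cases *)

Lemma sgtype_embdim_of_PF (S : set nat) (M : int) (b : nat) :
  finite_set (Irr S) -> Irr S b -> PF S = subl M (Irr S `\ b) ->
  ((sgtype S)%:Z = (embdim S)%:Z - 1)%R.
Proof.
move=> finI Ib PFE; rewrite /sgtype /embdim /ncard PFE /subl.
rewrite fset_set_image; last exact: finite_setD.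
rewrite card_imfset /=; last by move=> x y /=; lia.
rewrite fset_setD1 // (cardfsD1 b (fset_set (Irr S))) in_fset_set // mem_set //.
by rewrite PoszD addrC addKr.
Qed.

Lemma gen2C (a b : nat) : gen2 a b = gen2 b a.
Proof.
by apply/seteqP; split=> _ [x [y ->]]; exists y, x; rewrite addnC.
Qed.

Lemma congruent_one_case (a b d : nat) :
  1 < a -> 1 < b -> 0 < d -> coprime a b -> coprime b d -> a = 1 %[mod d] ->
  let S := quot (gen2 a b) d in
  PF S = subl (Posz (((a - 1) * b) %/ d)) (Irr S `\ b) /\
  ((sgtype S)%:Z = (embdim S)%:Z - 1)%R.
Proof.
move=> a1 b1 d0 cab cbd amod S.
have /dvdnP[q aq] : d %| a - 1 by rewrite -eqn_mod_dvd 1?ltnW //; apply/eqP.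
have aE : a = q * d + 1 by lia.
have q0 : 0 < q by case: q aq aE => [|//]; lia.
have -> : (a - 1) * b %/ d = q * b by rewrite aq mulnAC mulnK.
have IE : Irr S = irreducibles S.
  exact/IrrE/submonoid_quot/submonoid_gen2.
have PFE : PF S = subl (Posz (q * b)) (Irr S `\ b).
  by rewrite IE; exact: PF_reflection.
split=> //; apply: (sgtype_embdim_of_PF _ _ PFE); rewrite IE.
  by apply: finite_irreducibles_quot; lia.
exact: (@irreducible_b a b d q).
Qed.

Lemma complemented_quot (a b d : nat) (F : int) :
  0 < b -> 0 < d -> coprime a b ->
  (d%:Z * F = a%:Z * b%:Z - a%:Z - b%:Z)%R ->
  forall z, intset (quot (gen2 a b) d) z <->
            ~ intset (quot (gen2 a b) d) (F - z)%R.
Proof.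
move=> b0 d0 cab dF z; rewrite !intset_quot // gen2_symmetry //.
by rewrite -dF mulrBr.
Qed.

Theorem theorem6 (a b d : nat)
    (ha : 0 < a) (hb : 0 < b) (hd : 0 < d)
    (hab : coprime a b) (had : coprime a d) (hbd : coprime b d)
    (hdS : ~ gen2 a b d) (hlt : a < b) :
  let S := quot (gen2 a b) d in
  [/\ (a - 1) * (b - 1) = 1 %[mod d] ->
        [/\ symmetric_sg S,
            sgtype S = 1,
            ((frob S)%:Q = (frob (gen2 a b))%:Q / d%:Q)%R &
            ((frob S)%:Q = (a%:Q * b%:Q - a%:Q - b%:Q) / d%:Q)%R],
      a = 1 %[mod d] ->
        PF S = subl (((a - 1) * b) %/ d)%:Z (Irr S `\ b),
      b = 1 %[mod d] ->
        PF S = subl (((b - 1) * a) %/ d)%:Z (Irr S `\ a) &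
      a = 1 %[mod d] \/ b = 1 %[mod d] ->
        ((sgtype S)%:Z = (embdim S)%:Z - 1)%R].
Proof.
(* If [a] were 1, [gen2 a b] would contain every natural number, [d] included. *)
have a1 : 1 < a.
  rewrite ltn_neqAle ha andbT; apply/eqP => a1; apply: hdS.
  by exists d, 0; rewrite -a1; lia.
have b1 : 1 < b by lia.
move=> S; have caseA := @congruent_one_case a b d a1 b1 hd hab hbd.
have caseB : b = 1 %[mod d] -> _ :=
  @congruent_one_case b a d b1 a1 hd (etrans (coprime_sym _ _) hab) had.
rewrite gen2C in caseB.
split=> [h|/caseA[]//|/caseB[]//|[/caseA[]//|/caseB[]//]].
(* [(a - 1) * (b - 1) - 1] is [a * b - a - b], so [f] is the expected Frobenius number. *)
have /dvdnP[f fE] : d %| (a - 1) * (b - 1) - 1.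
  by rewrite -eqn_mod_dvd; [apply/eqP|nia].
have dF : (d%:Z * f%:Z = a%:Z * b%:Z - a%:Z - b%:Z)%R.
  have gt0 : 0 < (a - 1) * (b - 1) by rewrite muln_gt0; lia.
  have /(congr1 Posz) : (a - 1) * (b - 1) = f * d + 1 by lia.
  by rewrite PoszM -!subzn //; lia.
have S0 : S 0 := (submonoid_quot d (submonoid_gen2 a b)).1.
have SF := complemented_quot hb hd hab dF.
have frobE : frob S = Posz f by exact: complemented_frob.
have frobG : frob (gen2 a b) = (a%:Z * b%:Z - a%:Z - b%:Z)%R.
  apply: complemented_frob => [|z]; last exact: gen2_symmetry.
  exact: (submonoid_gen2 a b).1.
have dQ : (d%:Q != 0)%R by rewrite intr_eq0; lia.
have fQ : ((frob S)%:Q = (a%:Q * b%:Q - a%:Q - b%:Q) / d%:Q)%R.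
  apply/(canRL (mulfK dQ)).
  by rewrite frobE -!intrM -!intrB -dF mulrC.
split=> //.
- exact: complemented_symmetric SF.
- exact: complemented_type SF.
- by rewrite fQ frobG !intrB intrM.
Qed.
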